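(* In the setting of the context, suppose the parameter matrices $\underline\sigma_{i+1/2}$ are given by a smooth matrix-valued map $\underline\sigma$ and satisfy $\underline\sigma_{i+1/2}-\underline\sigma_{i-1/2}=O(\Delta x)$. Then the finite volume scheme $$\frac{1}{\Delta t}(U_i^{m+1}-U_i^m)+\frac1{\Delta x}\big(\underline\alpha_{i+1/2}F^{HLL}_{i+1/2}-\underline\alpha_{i-1/2}F^{HLL}_{i-1/2}\big)=\frac1{\Delta x}\big(\underline\alpha_{i+1/2}-\underline\alpha_{i-1/2}\big)F(U_i^m)-\frac\gamma2\big(\underline\alpha_{i+1/2}+\underline\alpha_{i-1/2}\big)R(U_i^m)$$ is consistent with the hyperbolic system with relaxation $\partial_tU+\partial_xF(U)=-\gamma R(U)$, and it satisfies the following invariant domain property: provided all the states $$U^{\star L}_{i+1/2}=\underline\alpha_{i+1/2}\widetilde U^\star_{i+1/2}+(I-\underline\alpha_{i+1/2})\big(U_i^m-\bar R_{i+1/2}(U_i^m)\big),$$ $$U^{\star R}_{i+1/2}=\underline\alpha_{i+1/2}\widetilde U^\star_{i+1/2}+(I-\underline\alpha_{i+1/2})\big(U_{i+1}^m-\bar R_{i+1/2}(U_{i+1}^m)\big)$$ belong to $\Omega$ (for all $i,m$), all of the states $U_i^m$ belong to $\Omega$.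
   Context: Let $\Omega\subset\mathbb R^N$ be open and convex, $F,R:\Omega\to\mathbb R^N$ smooth, $\gamma>0$, and suppose $D_UF(U)$ has real eigenvalues and a full basis of eigenvectors for each $U\in\Omega$. Use a uniform mesh with cells $[x_{i-1/2},x_{i+1/2}]$ of length $\Delta x$, $x_{i+1/2}=x_i+\Delta x/2$, $i\in\mathbb Z$, and times $t^{m+1}=t^m+\Delta t$. A constant $b>0$ (sufficiently large) is fixed and the CFL condition $b\,\Delta t/\Delta x\le1/2$ is imposed. The initial cell values $U_i^0$ lie in $\Omega$. Define $$F^{HLL}_{i+1/2}=\tfrac12\big(F(U_i^m)+F(U_{i+1}^m)\big)-\tfrac b2(U_{i+1}^m-U_i^m),$$ $$\widetilde U^\star_{i+1/2}=\tfrac12(U_i^m+U_{i+1}^m)-\tfrac1{2b}\big(F(U_{i+1}^m)-F(U_i^m)\big).$$ At each interface an $N\times N$ parameter matrix $\underline\sigma_{i+1/2}$ is given and $$\underline\alpha_{i+1/2}=\Big(I+\tfrac{\gamma\Delta x}{2b}(I+\underline\sigma_{i+1/2})\Big)^{-1},\qquad \bar R_{i+1/2}(U)=(I+\underline\sigma_{i+1/2})^{-1}R(U),$$ all the inverse matrices being assumed to exist. Consistency means that, when $U_i^m$ is replaced by $U(t^m,x_i)$ for a smooth function $U(t,x)$ with values in $\Omega$, the difference of the two sides of the scheme equals $\partial_tU+\partial_xF(U)+\gamma R(U)$ at $(t^m,x_i)$ up to an error tending to $0$ as $\Delta t,\Delta x\to0$. *)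

(* Defs.v *)
(* R^N is the type 'cV[R]_N of column vectors, so that
   matrices act on states from the left. *)
From HB Require Import structures.
From mathcomp Require Import all_boot all_order all_algebra.
From mathcomp Require Import all_classical all_reals all_analysis.

Set Implicit Arguments.
Unset Strict Implicit.
Unset Printing Implicit Defensive.

Import Order.TTheory GRing.Theory Num.Theory.
Import numFieldNormedType.Exports.

Local Open Scope classical_set_scope.
Local Open Scope ring_scope.

(* On an open set A of a finite-dimensional space, [class_on n A f] is the
   usual f \in C^n(A): all iterated directional derivatives up to order n
   exist on A and are continuous there. *)
Fixpoint class_on (R : realType) (V W : normedModType R) (n : nat)
    (A : set V) (f : V -> W) : Prop :=
  match n with
  | 0%N => forall x, A x -> {for x, continuous f}
  | n'.+1 => (forall x, A x -> differentiable f x) /\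
             (forall v, class_on n' A (fun x => 'D_v f x))
  end.

Definition smooth_on (R : realType) (V W : normedModType R)
    (A : set V) (f : V -> W) : Prop :=
  forall n, class_on n A f.

(* D_U F(u) has a basis of (real) eigenvectors: the columns of P. *)
Definition hyperbolic_at (R : realType) (N : nat)
    (F : 'cV[R]_N -> 'cV[R]_N) (u : 'cV[R]_N) : Prop :=
  exists (lambda : 'I_N -> R) (P : 'M[R]_N), P \in unitmx /\
    forall k, 'd F u (col k P) = lambda k *: col k P.

Record mesh (R : realType) := Mesh {
  time_origin : R;
  space_origin : R;
  Dt : R;
  Dx : R }.

Definition time (R : realType) (M : mesh R) (m : nat) : R :=
  time_origin M + m%:R * Dt M.

Definition node (R : realType) (M : mesh R) (i : int) : R :=
  space_origin M + i%:~R * Dx M.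

Definition interface (R : realType) (M : mesh R) (i : int) : R :=
  node M i + Dx M / 2.

(* Positive steps subject to the CFL condition. *)
Definition admissible_mesh (R : realType) (b : R) (M : mesh R) : Prop :=
  [/\ 0 < Dt M, 0 < Dx M & b * Dt M / Dx M <= 2^-1].

(* A grid function [U : nat -> int -> 'cV[R]_N] has values U_i^m = U m i.
   In the definitions below, the index [i] of an interface quantity stands for
   the interface x_{i+1/2}; hence [i - 1] stands for x_{i-1/2}. *)
Section scheme.
Variables (R : realType) (N : nat).
Variables (F Rel : 'cV[R]_N -> 'cV[R]_N) (gamma b : R).
(* The arguments of [sigma] are (t, x, left state, right state). *)
Variable sigma : R * R * 'cV[R]_N * 'cV[R]_N -> 'M[R]_N.
Variables (M : mesh R) (U : nat -> int -> 'cV[R]_N).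

Definition F_HLL m i : 'cV[R]_N :=
  2^-1 *: (F (U m i) + F (U m (i + 1)))
  - (b / 2) *: (U m (i + 1) - U m i).

Definition Ustar_tilde m i : 'cV[R]_N :=
  2^-1 *: (U m i + U m (i + 1))
  - (2 * b)^-1 *: (F (U m (i + 1)) - F (U m i)).

Definition sigma_half m i : 'M[R]_N :=
  sigma (time M m, interface M i, U m i, U m (i + 1)).

Definition Isigma m i : 'M[R]_N := 1%:M + sigma_half m i.

Definition alpha_inv m i : 'M[R]_N :=
  1%:M + (gamma * Dx M / (2 * b)) *: Isigma m i.

(* [invmx] is the inverse only on [unitmx]; every use of [alpha] or [Rbar] is
   accompanied by the hypothesis that the inverted matrix is in [unitmx]. *)
Definition alpha m i : 'M[R]_N := invmx (alpha_inv m i).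

Definition Rbar m i (u : 'cV[R]_N) : 'cV[R]_N :=
  invmx (Isigma m i) *m Rel u.

Definition scheme_lhs m i : 'cV[R]_N :=
  (Dt M)^-1 *: (U m.+1 i - U m i)
  + (Dx M)^-1 *: (alpha m i *m F_HLL m i
                  - alpha m (i - 1) *m F_HLL m (i - 1)).

Definition scheme_rhs m i : 'cV[R]_N :=
  (Dx M)^-1 *: ((alpha m i - alpha m (i - 1)) *m F (U m i))
  - (gamma / 2) *: ((alpha m i + alpha m (i - 1)) *m Rel (U m i)).

Definition solves_scheme : Prop :=
  forall m i, scheme_lhs m i = scheme_rhs m i.

Definition Ustar_L m i : 'cV[R]_N :=
  alpha m i *m Ustar_tilde m i
  + (1%:M - alpha m i) *m (U m i - Rbar m i (U m i)).

Definition Ustar_R m i : 'cV[R]_N :=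
  alpha m i *m Ustar_tilde m i
  + (1%:M - alpha m i) *m (U m (i + 1) - Rbar m i (U m (i + 1))).

End scheme.

Definition sample (R : realType) (N : nat) (M : mesh R)
    (U : R * R -> 'cV[R]_N) : nat -> int -> 'cV[R]_N :=
  fun m i => U (time M m, node M i).

(* sigma_{i+1/2} - sigma_{i-1/2} = O(Dx) as the mesh is refined, the states
   being the nodal values of a fixed smooth function; the O is uniform for
   (t^m, x_i) in a compact set. *)
Definition sigma_variation_O (R : realType) (N : nat) (Omega : set 'cV[R]_N)
    (b : R) (sigma : R * R * 'cV[R]_N * 'cV[R]_N -> 'M[R]_N) : Prop :=
  forall U : R * R -> 'cV[R]_N,
    smooth_on setT U -> (forall p, Omega (U p)) ->
  forall K : set (R * R), compact K ->
  exists C d : R, 0 < d /\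
    forall M : mesh R, admissible_mesh b M -> Dt M < d -> Dx M < d ->
    forall m i, K (time M m, node M i) ->
      `|sigma_half sigma M (sample M U) m i
        - sigma_half sigma M (sample M U) m (i - 1)| <= C * Dx M.

(* The truncation error tends to 0, uniformly for (t^m, x_i) in a compact
   set and uniformly in the origin of the mesh. *)
Definition consistent (R : realType) (N : nat) (Omega : set 'cV[R]_N)
    (F Rel : 'cV[R]_N -> 'cV[R]_N) (gamma b : R)
    (sigma : R * R * 'cV[R]_N * 'cV[R]_N -> 'M[R]_N) : Prop :=
  forall U : R * R -> 'cV[R]_N,
    smooth_on setT U -> (forall p, Omega (U p)) ->
  forall K : set (R * R), compact K ->
  forall e : R, 0 < e ->
  exists d : R, 0 < d /\
    forall M : mesh R, admissible_mesh b M -> Dt M < d -> Dx M < d ->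
    forall m i, K (time M m, node M i) ->
      let V := sample M U in
      let t := time M m in
      let x := node M i in
      alpha_inv gamma b sigma M V m i \in unitmx ->
      alpha_inv gamma b sigma M V m (i - 1) \in unitmx ->
      `|scheme_lhs F gamma b sigma M V m i
        - scheme_rhs F Rel gamma b sigma M V m i
        - (derive1 (fun s => U (s, x)) t
           + derive1 (fun y => F (U (t, y))) x
           + gamma *: Rel (U (t, x)))| <= e.

Definition invariant_domain (R : realType) (N : nat) (Omega : set 'cV[R]_N)
    (F Rel : 'cV[R]_N -> 'cV[R]_N) (gamma b : R)
    (sigma : R * R * 'cV[R]_N * 'cV[R]_N -> 'M[R]_N) : Prop :=
  forall (M : mesh R) (U : nat -> int -> 'cV[R]_N),
    admissible_mesh b M ->
    (forall i, Omega (U 0%N i)) ->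
    (forall m i, alpha_inv gamma b sigma M U m i \in unitmx) ->
    (forall m i, Isigma sigma M U m i \in unitmx) ->
    solves_scheme F Rel gamma b sigma M U ->
    (forall m i, Omega (Ustar_L F Rel gamma b sigma M U m i) /\
                 Omega (Ustar_R F Rel gamma b sigma M U m i)) ->
    forall m i, Omega (U m i).

(* Main.v *)
(* Consistency: after subtracting the (alpha_{i+1/2} - alpha_{i-1/2}) F(U_i)
   term, the flux difference equals
     alpha_{i+1/2} (F^HLL_{i+1/2} - F(U_i)) - alpha_{i-1/2} (F^HLL_{i-1/2} - F(U_i)),
   which only involves the forward and backward difference quotients of F(U)
   and U, with the b-terms of opposite signs. As Dt, Dx -> 0 and the node tends
   to a point p, the quotients tend to the derivatives at p and both alpha to I,
   so the truncation error tends to 0 jointly in the node and the steps;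
   compactness turns this into uniformity.

   Invariance: (I - alpha)(I + sigma)^-1 = (gamma Dx / 2b) alpha, hence, with
   l = b Dt / Dx <= 1/2,
     U_i^{m+1} = (1 - 2 l) U_i^m + l (U^{*L}_{i+1/2} + U^{*R}_{i-1/2}),
   a convex combination of points of Omega. *)
Require Import Defs.
From HB Require Import structures.
From mathcomp Require Import all_boot all_order all_algebra.
From mathcomp Require Import all_classical all_reals all_analysis.
From mathcomp Require Import ring lra.

Set Implicit Arguments.
Unset Strict Implicit.
Unset Printing Implicit Defensive.

Import Order.TTheory GRing.Theory Num.Theory.
Import numFieldNormedType.Exports.

Local Open Scope classical_set_scope.
Local Open Scope ring_scope.

(** * Limits and norm bounds for matrices *)

Lemma cvg_mx (T : Type) (G : set_system T) {FG : Filter G} (S : topologicalType)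
    (m n : nat) (f : T -> 'M[S]_(m, n)) (A : 'M[S]_(m, n)) :
  (forall i j, f x i j @[x --> G] --> A i j) -> f x @[x --> G] --> A.
Proof.
move=> fA B [P AP PB].
have : \forall x \near G, forall i j, P i j (f x i j).
  apply: filter_forall => i; apply: filter_forall => j.
  exact: (fA i j (P i j) (AP i j)).
by apply: filterS => x; apply: PB.
Qed.

Lemma cvg_mx_coord (T : Type) (G : set_system T) {FG : Filter G}
    (K : numFieldType) (m n : nat) (f : T -> 'M[K]_(m, n)) (A : 'M[K]_(m, n)) i j :
  f x @[x --> G] --> A -> f x i j @[x --> G] --> A i j.
Proof.
move=> fA; apply: (cvg_comp f (fun M : 'M[K]_(m, n) => M i j) fA).
exact: coord_continuous.
Qed.

Lemma cvg_mulmx (T : Type) (G : set_system T) {FG : Filter G}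
    (K : numFieldType) (m n p : nat) (f : T -> 'M[K]_(m, n)) (g : T -> 'M[K]_(n, p))
    (A : 'M[K]_(m, n)) (B : 'M[K]_(n, p)) :
  f x @[x --> G] --> A -> g x @[x --> G] --> B ->
  f x *m g x @[x --> G] --> A *m B.
Proof.
move=> fA gB; apply: cvg_mx => i j.
rewrite mxE; under eq_fun do rewrite mxE.
apply: cvg_big => [|k _]; first exact: add_continuous.
by apply: cvgM; apply: cvg_mx_coord.
Qed.

Lemma mx_entry_le_norm (K : realFieldType) m n (A : 'M[K]_(m, n)) i j :
  `|A i j| <= `|A|.
Proof.
by rewrite [leRHS]/Num.Def.normr /= mx_normrE; exact: (le_bigmax _ _ (i, j)).
Qed.

Lemma mx_norm_le (K : realFieldType) m n (A : 'M[K]_(m, n)) (e : K) :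
  0 <= e -> (forall i j, `|A i j| <= e) -> `|A| <= e.
Proof.
move=> e0 Ae; rewrite [leLHS]/Num.Def.normr /= mx_normrE.
by apply: bigmax_le => // -[i j] _; exact: Ae.
Qed.

(** The norm is the largest absolute entry, which is not submultiplicative; the factor [n] counts
    the terms of each entry of the product. *)
Lemma normM_mx (K : realFieldType) m n p (A : 'M[K]_(m, n)) (B : 'M[K]_(n, p)) :
  `|A *m B| <= n%:R * (`|A| * `|B|).
Proof.
apply: mx_norm_le => [|i j]; first by rewrite !mulr_ge0.
rewrite mxE (le_trans (ler_norm_sum _ _ _))//.
rewrite mulr_natl -[n in _ *+ n]card_ord -sumr_const ler_sum// => k _.
by rewrite normrM ler_pM// mx_entry_le_norm.
Qed.

(** Neumann-type estimate: the fixed-point identity [B1] for [invmx A - 1%:M] has a contraction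
    factor at most 1/2, so its last term is absorbed on the left. *)
Lemma norm_invmx_sub1 (K : realFieldType) n (A : 'M[K]_n) :
  n%:R * `|A - 1%:M| <= 2^-1 ->
  `|invmx A - 1%:M| <= 2 * `|A - 1%:M|.
Proof.
move=> A1; have [uA|nuA] := boolP (A \in unitmx); last first.
  (* For a singular [A] the default value is [invmx A = A], and the bound is trivial. *)
  rewrite /invmx (negbTE nuA) ler_peMl//.
  by rewrite ler1n.
have B1 : invmx A - 1%:M = (1%:M - A) + (1%:M - A) *m (invmx A - 1%:M).
  by rewrite mulmxBr mulmx1 [RHS]addrC subrK mulmxBl mulmxV// mul1mx.
have : `|invmx A - 1%:M| <= `|A - 1%:M| + 2^-1 * `|invmx A - 1%:M|.
  rewrite {1}B1 (le_trans (ler_normD _ _))// distrC lerD2l.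
  rewrite (le_trans (normM_mx _ _))// mulrA distrC.
  by rewrite ler_wpM2r.
lra.
Qed.

Lemma cvg_invmx1 (T : Type) (G : set_system T) {FG : Filter G}
    (K : realFieldType) (n : nat) (f : T -> 'M[K]_n) :
  f x @[x --> G] --> (1%:M : 'M[K]_n) ->
  invmx (f x) @[x --> G] --> (1%:M : 'M[K]_n).
Proof.
move=> /cvgrPdist_le f1; apply/cvgrPdist_le => e e0.
(* With [n + 1] in place of [n] the radius is meaningful for [n = 0] too, and it still forces the
   1/2 bound of [norm_invmx_sub1]. *)
have n0 : 0 < 2 * (n%:R + 1) :> K by rewrite mulr_gt0// ltr_wpDl.
near=> x.
have fx : `|f x - 1%:M| <= (2 * (n%:R + 1))^-1.
  by rewrite distrC; near: x; apply: f1; rewrite invr_gt0.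
rewrite distrC (le_trans (norm_invmx_sub1 _))//.
  rewrite (le_trans (ler_wpM2l _ fx))// invfM mulrA.
  by rewrite ler_pdivrMr ?ltr_wpDl// mulrC ler_wpM2l ?invr_ge0// lerDl.
rewrite mulrC -ler_pdivlMr// distrC; near: x.
by apply: f1; rewrite divr_gt0.
Unshelve. all: by end_near. Qed.

(** * Mean value theorem and difference quotients along a direction *)

Lemma is_derive_line (R : realType) (V W : normedModType R) (G : V -> W)
    (q v : V) (s : R) :
  derivable G (q + s *: v) v ->
  is_derive s 1 (fun s => G (q + s *: v)) ('D_v G (q + s *: v)).
Proof.
have E : (fun h : R => h^-1 *:
      (((fun s => G (q + s *: v)) \o shift s) (h *: 1) - G (q + s *: v))) =
    (fun h : R => h^-1 *:
      ((G \o shift (q + s *: v)) (h *: v) - G (q + s *: v))).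
  apply/funext => h /=; congr (_ *: (G _ - _)).
  by rewrite [h *: 1]mulr1 scalerDl addrCA.
move=> dG; apply: DeriveDef; first by rewrite /derivable E.
by rewrite /derive E.
Qed.

(** Both signs of [h] are covered, because the left interface leads to quotients with negative
    step. *)
Lemma MVT_line (R : realType) (V : normedModType R) (G : V -> R) (q v : V)
    (h : R) :
  (forall x, derivable G x v) ->
  exists2 c, `|c| <= `|h| & G (q + h *: v) - G q = 'D_v G (q + c *: v) * h.
Proof.
move=> dG.
have dphi (s : R) : is_derive s 1 (fun s => G (q + s *: v)) ('D_v G (q + s *: v)).
  exact: is_derive_line.
have cphi (A : set R) : {within A, continuous (fun s => G (q + s *: v))}.
  apply: continuous_subspaceT => s; apply: differentiable_continuous.
  by apply/derivable1_diffP; apply: ex_derive.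
have [h0|/ltW h0] := leP 0 h.
  have [c] := MVT_segment h0 (fun s _ => dphi s) (cphi _).
  rewrite in_itv /= scale0r addr0 subr0 => /andP[c0 ch] ->.
  by exists c => //; rewrite !ger0_norm.
have [c] := MVT_segment h0 (fun s _ => dphi s) (cphi _).
rewrite in_itv /= scale0r addr0 sub0r => /andP[hc c0] E.
exists c; first by rewrite !ler0_norm// lerN2.
by rewrite -opprB E mulrN opprK.
Qed.

Definition diff_quotient (R : realType) (V W : normedModType R) (G : V -> W)
    (v : V) (z : V * R) : W :=
  z.2^-1 *: (G (z.1 + z.2 *: v) - G z.1).

(** Differentiability at [p] alone would not do, since the base point moves together with the step.
    The mean value theorem turns the quotient into ['D_v G] at a nearby point, where continuity at
    [p] applies. *)
Lemma cvg_diff_quotient1 (R : realType) (V : normedModType R) (G : V -> R)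
    (v p : V) :
  (forall x, derivable G x v) -> {for p, continuous ('D_v G)} ->
  z.2^-1 * (G (z.1 + z.2 *: v) - G z.1) @[z --> filter_prod (nbhs p) 0^'] -->
  'D_v G p.
Proof.
move=> dG cG.
(* The full neighbourhood of 0 is used here, not the punctured one, since the mean value parameter
   may vanish. *)
have c2 : (fun z : V * R => 'D_v G (z.1 + z.2 *: v)) @ (p, 0 : R) --> 'D_v G p.
  apply: (cvg_comp (fun z : V * R => z.1 + z.2 *: v) ('D_v G) _ cG).
  suff : z.1 + z.2 *: v @[z --> (p, 0 : R)] --> p + 0 *: v by rewrite scale0r addr0.
  apply: cvgD; first exact: cvg_fst.
  by apply: cvgZr_tmp; exact: cvg_snd.
apply/cvgrPdist_le => e e0.
move/cvgrPdist_le : c2 => /(_ e e0)[[A B] /= [pA /nbhs_ballP[d /= d0 dB]] AB].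
exists (A, [set h | h != 0 /\ `|h| < d]).
  split => //=; near=> h; split; first by near: h; exact: nbhs_dnbhs_neq.
  by near: h; exact: dnbhs0_lt.
move=> [q h] /= [Aq [h0 hd]].
have [c ch ->] := MVT_line q h dG.
rewrite mulrCA mulVf// mulr1.
apply: (AB (q, c)); split => //=; apply: dB.
by rewrite -ball_normE /= sub0r normrN (le_lt_trans ch).
Unshelve. all: by end_near. Qed.

(** The mean value equality holds only for scalar functions, hence the passage to entries. *)
Lemma cvg_diff_quotient (R : realType) (V : normedModType R) (m n : nat)
    (G : V -> 'M[R]_(m, n)) (v p : V) :
  (forall x, derivable G x v) -> {for p, continuous ('D_v G)} ->
  diff_quotient G v z @[z --> filter_prod (nbhs p) 0^'] --> 'D_v G p.
Proof.
move=> dG cG; apply: cvg_mx => i j.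
have dGij x : derivable (fun x => G x i j) x v by move/derivable_mxP: (dG x).
have DE x : 'D_v G x i j = 'D_v (fun x => G x i j) x by rewrite derive_mx// mxE.
rewrite DE; under eq_fun do rewrite !mxE.
apply: cvg_diff_quotient1 => //.
have -> : 'D_v (fun x => G x i j) = (fun x => 'D_v G x i j) by apply/funext => x.
exact: cvg_mx_coord.
Qed.

(** * Invariant domain property *)

Lemma convex_set_half_sum (R : realType) (V : lmodType R) (A : set V)
    (u v w : V) (l : R) : convex_set A -> A u -> A v -> A w ->
  0 <= l <= 2^-1 -> A (u + l *: ((v - u) + (w - u))).
Proof.
move=> cA Au Av Aw /andP[l0 l2].
have cvx (x y : V) (k : R) : A x -> A y -> 0 <= k -> k <= 1 -> A (k *: x + (1 - k) *: y).
  move=> Ax Ay k0 k1.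
  have := cA x y (Itv01 k0 k1); rewrite !inE => /(_ Ax Ay).
  by [].
have Am : A (2^-1 *: v + (1 - 2^-1) *: w).
  by apply: cvx => //; rewrite ?invr_ge0// invf_le1// ler1n.
(* Weight [2 l] goes to the midpoint of [v] and [w], and [1 - 2 l] to [u]; the bound [l <= 1/2] from
   the CFL condition keeps both nonnegative. *)
have -> : u + l *: ((v - u) + (w - u)) =
    (l * 2) *: (2^-1 *: v + (1 - 2^-1) *: w) + (1 - l * 2) *: u.
  have -> : 1 - 2^-1 = 2^-1 :> R by field.
  rewrite -scalerDr scalerA mulfK// scalerBl scale1r.
  rewrite addrACA -opprD -mulr2n -scaler_nat scalerBr scalerA.
  by rewrite addrCA.
apply: cvx => //; first by rewrite mulr_ge0.
by rewrite -ler_pdivlMr// div1r.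
Qed.

Section update.
Variables (R : realType) (N : nat).
Variables (F Rel : 'cV[R]_N -> 'cV[R]_N) (gamma b : R).
Variable sigma : R * R * 'cV[R]_N * 'cV[R]_N -> 'M[R]_N.
Variables (M : mesh R) (U : nat -> int -> 'cV[R]_N).

Lemma one_sub_alpha_Rbar m i (u : 'cV[R]_N) :
  alpha_inv gamma b sigma M U m i \in unitmx -> Isigma sigma M U m i \in unitmx ->
  (1%:M - alpha gamma b sigma M U m i) *m Rbar Rel sigma M U m i u =
  (gamma * Dx M / (2 * b)) *: (alpha gamma b sigma M U m i *m Rel u).
Proof.
move=> ua ui.
(* Here [1%:M] is written as [alpha] times [alpha_inv], and [alpha_inv - 1%:M] is the multiple of
   [Isigma] that cancels the inverse in [Rbar]. *)
have -> : 1%:M - alpha gamma b sigma M U m i =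
    (gamma * Dx M / (2 * b)) *: (alpha gamma b sigma M U m i *m Isigma sigma M U m i).
  rewrite -[1%:M in LHS](mulVmx ua) -/(alpha gamma b sigma M U m i).
  by rewrite -{2}[alpha _ _ _ _ _ _ _]mulmx1 -mulmxBr /alpha_inv addrC addKr scalemxAr.
by rewrite /Rbar mulmxA -scalemxAl mulmxK// -scalemxAl.
Qed.

Let al := alpha gamma b sigma M U.

Lemma Ustar_L_sub m i : b != 0 ->
  alpha_inv gamma b sigma M U m i \in unitmx -> Isigma sigma M U m i \in unitmx ->
  Ustar_L F Rel gamma b sigma M U m i - U m i =
  - (b^-1 *: (al m i *m (F_HLL F b U m i - F (U m i))))
  - (gamma * Dx M / (2 * b)) *: (al m i *m Rel (U m i)).
Proof.
move=> b0 ua ui; rewrite /Ustar_L [(1%:M - _) *m _]mulmxBr one_sub_alpha_Rbar// -/(al m i).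
rewrite mulmxBl mul1mx [b^-1 *: _]scalemxAr.
(* Rankine-Hugoniot relation across the HLL wave of speed [-b]; the right state uses the wave of
   speed [b]. *)
have -> : b^-1 *: (F_HLL F b U m i - F (U m i)) = U m i - Ustar_tilde F b U m i.
  apply/colP => k; rewrite !mxE; field; exact: b0.
move: (Ustar_tilde _ _ _ _ _) => w; rewrite mulmxBr opprB.
move: (al m i *m _) (al m i *m _) (_ *: _) => x y z.
by apply/colP => k; rewrite !mxE; ring.
Qed.

Lemma Ustar_R_sub m i : b != 0 ->
  alpha_inv gamma b sigma M U m i \in unitmx -> Isigma sigma M U m i \in unitmx ->
  Ustar_R F Rel gamma b sigma M U m i - U m (i + 1) =
  b^-1 *: (al m i *m (F_HLL F b U m i - F (U m (i + 1))))
  - (gamma * Dx M / (2 * b)) *: (al m i *m Rel (U m (i + 1))).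
Proof.
move=> b0 ua ui; rewrite /Ustar_R [(1%:M - _) *m _]mulmxBr one_sub_alpha_Rbar// -/(al m i).
rewrite mulmxBl mul1mx [b^-1 *: _]scalemxAr.
have -> : b^-1 *: (F_HLL F b U m i - F (U m (i + 1))) =
    Ustar_tilde F b U m i - U m (i + 1).
  by apply/colP => k; rewrite !mxE; field; exact: b0.
move: (Ustar_tilde _ _ _ _ _) => w; rewrite mulmxBr.
move: (al m i *m _) (al m i *m _) (_ *: _) => x y z.
by apply/colP => k; rewrite !mxE; ring.
Qed.

Lemma scheme_update m i : b != 0 -> Dt M != 0 -> Dx M != 0 ->
  (forall m i, alpha_inv gamma b sigma M U m i \in unitmx) ->
  (forall m i, Isigma sigma M U m i \in unitmx) ->
  scheme_lhs F gamma b sigma M U m i = scheme_rhs F Rel gamma b sigma M U m i ->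
  U m.+1 i = U m i + (b * Dt M / Dx M) *:
    ((Ustar_L F Rel gamma b sigma M U m i - U m i)
     + (Ustar_R F Rel gamma b sigma M U m (i - 1) - U m i)).
Proof.
move=> b0 dt0 dx0 ua ui.
have := Ustar_R_sub b0 (ua m (i - 1)) (ui m (i - 1)); rewrite subrK => ->.
rewrite Ustar_L_sub// /scheme_lhs /scheme_rhs -/(al m i) -/(al m (i - 1)).
move: (F_HLL _ _ _ m i) (F_HLL _ _ _ m (i - 1)) => H H'.
rewrite !mulmxBl !mulmxDl !mulmxBr.
move: (al m i *m H) (al m i *m F _) (al m i *m Rel _) => H0 F0 R0.
move: (al m (i - 1) *m H') (al m (i - 1) *m F _) (al m (i - 1) *m Rel _).
move=> K' F' R' E.
(* The new value is expressed through the time quotient, which the scheme equation [E] then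
   replaces. With the matrix products generalised, a scalar identity per coordinate remains. *)
have -> : U m.+1 i = U m i + Dt M *: ((Dt M)^-1 *: (U m.+1 i - U m i)).
  by rewrite scalerA divff// scale1r addrC subrK.
rewrite (canRL (addrK _) E).
by apply/colP => k; rewrite !mxE; field; rewrite b0.
Qed.

End update.

Lemma invariant_domain_convex (R : realType) (N : nat) (Omega : set 'cV[R]_N)
    (F Rel : 'cV[R]_N -> 'cV[R]_N) (gamma b : R)
    (sigma : R * R * 'cV[R]_N * 'cV[R]_N -> 'M[R]_N) :
  convex_set Omega -> 0 < b -> invariant_domain Omega F Rel gamma b sigma.
Proof.
move=> cO b0 M U [dt0 dx0 cfl] U0 ua ui sol star; elim=> [//|m IHm] i.
rewrite (scheme_update _ _ _ ua ui (sol m i)) ?gt_eqF//.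
apply: convex_set_half_sum => //; [exact: (star m i).1|exact: (star m (i - 1)).2|].
by rewrite cfl andbT divr_ge0 ?mulr_ge0 // ltW.
Qed.

(** * Filters and derivatives of smooth composites *)

Lemma cvg_pair_nbhs (T : Type) (G : set_system T) {FG : Filter G}
    (A B : topologicalType) (f : T -> A) (g : T -> B) (a : A) (b : B) :
  f x @[x --> G] --> a -> g x @[x --> G] --> b ->
  (f x, g x) @[x --> G] --> (a, b).
Proof. by move=> fa gb; exact: (cvg_pair fa gb). Qed.

Lemma dnbhs0_opp (R : realType) : -%R @ (0 : R)^' --> (0 : R)^'.
Proof.
move=> A /nbhs_ballP[d d0 dA]; apply/nbhs_ballP; exists d => // h.
rewrite -ball_normE /= sub0r normrN => hd h0; apply: dA; last by rewrite oppr_eq0.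
by rewrite -ball_normE /= sub0r opprK.
Qed.

Lemma smooth_on_differentiable (R : realType) (V W : normedModType R) (A : set V)
  (f : V -> W) x : smooth_on A f -> A x -> differentiable f x.
Proof. by move=> /(_ 1%N)[+ _]; exact. Qed.

Lemma smooth_on_continuous (R : realType) (V W : normedModType R) (A : set V)
  (f : V -> W) x : smooth_on A f -> A x -> {for x, continuous f}.
Proof. by move=> /(_ 0%N); exact. Qed.

Lemma smooth_on_continuous_derive (R : realType) (V W : normedModType R) (A : set V)
  (f : V -> W) v x : smooth_on A f -> A x -> {for x, continuous ('D_v f)}.
Proof. by move=> /(_ 1%N)[_ /(_ v)]; exact. Qed.

Lemma diff_cV (R : realType) (N : nat) (W : normedModType R) (F : 'cV[R]_N -> W) u w :
  differentiable F u -> 'd F u w = \sum_(j < N) w j 0 *: 'D_(delta_mx j 0) F u.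
Proof.
move=> dF; rewrite [in LHS](matrix_sum_delta w) linear_sum.
by apply: eq_bigr => j _; rewrite big_ord1 linearZ /= deriveE.
Qed.

(** The chain rule differentiates [F] in the moving direction ['D_v U x]. Expanding it in the
    standard basis leaves derivatives of [F] in fixed directions, whose continuity [smooth_on]
    provides. *)
Lemma continuous_derive_comp (R : realType) (N : nat) (V W : normedModType R)
    (Omega : set 'cV[R]_N) (U : V -> 'cV[R]_N) (F : 'cV[R]_N -> W) (v p : V) :
  smooth_on Omega F -> smooth_on setT U -> (forall x, Omega (U x)) ->
  {for p, continuous ('D_v (F \o U))}.
Proof.
move=> sF sU OU.
have dF x : differentiable F (U x) by apply: smooth_on_differentiable sF (OU x).
have dU x : differentiable U x by apply: smooth_on_differentiable sU _.
have -> : 'D_v (F \o U) =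
    (fun x => \sum_(j < N) 'D_v U x j 0 *: 'D_(delta_mx j 0) F (U x)).
  apply/funext => x; rewrite deriveE; last exact: differentiable_comp.
  by rewrite diff_comp//= diff_cV// -deriveE.
apply: cvg_big => [|j _]; first exact: add_continuous.
apply: cvgZ; first by apply: cvg_mx_coord; exact: smooth_on_continuous_derive sU _.
apply: (cvg_comp U ('D_(delta_mx j 0) F)); first exact: smooth_on_continuous sU _.
exact: smooth_on_continuous_derive sF _.
Qed.

(** * Truncation error: limit, link with the scheme, uniformity *)

Section truncation.
Variables (R : realType) (N : nat) (Omega : set 'cV[R]_N).
Variables (F Rel : 'cV[R]_N -> 'cV[R]_N) (gamma b : R).
Variable sigma : R * R * 'cV[R]_N * 'cV[R]_N -> 'M[R]_N.
Variable U : R * R -> 'cV[R]_N.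

Let et : R * R := (1, 0).
Let ex : R * R := (0, 1).

Definition alpha_of (h : R) (S : 'M[R]_N) : 'M[R]_N :=
  invmx (1%:M + (gamma * h / (2 * b)) *: (1%:M + S)).

(** Free variables [q] and [h] replace the mesh and its indices, so that limits can be taken;
    likewise in [alpha_left], which looks backward. *)
Definition alpha_right (q : R * R) (h : R) : 'M[R]_N :=
  alpha_of h (sigma (q.1, q.2 + h / 2, U q, U (q + h *: ex))).

Definition alpha_left (q : R * R) (h : R) : 'M[R]_N :=
  alpha_of h (sigma (q.1, q.2 + (- h) / 2, U (q + (- h) *: ex), U q)).

(* The left-hand side of the scheme minus its right-hand side minus the PDE
   residual, at the node [q = (t, x)] for time step [k] and space step [h]. *)
Definition truncation_error (q : R * R) (k h : R) : 'cV[R]_N :=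
  diff_quotient U et (q, k)
  + 2^-1 *: (alpha_right q h *m
       (diff_quotient (F \o U) ex (q, h) - b *: diff_quotient U ex (q, h)))
  + 2^-1 *: (alpha_left q h *m
       (diff_quotient (F \o U) ex (q, - h) + b *: diff_quotient U ex (q, - h)))
  + (gamma / 2) *: ((alpha_right q h + alpha_left q h) *m Rel (U q))
  - ('D_et U q + 'D_ex (F \o U) q + gamma *: Rel (U q)).

Lemma cvg_alpha_of (T : Type) (G : set_system T) {FG : Filter G}
    (h : T -> R) (S : T -> 'M[R]_N) (S0 : 'M[R]_N) :
  h z @[z --> G] --> 0 -> S z @[z --> G] --> S0 ->
  alpha_of (h z) (S z) @[z --> G] --> (1%:M : 'M[R]_N).
Proof.
move=> h0 SS0; apply: cvg_invmx1.
rewrite -[X in _ --> X]addr0; apply: cvgD; first exact: cvg_cst.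
rewrite -(scale0r (1%:M + S0)); apply: cvgZ; last first.
  by apply: cvgD => //; exact: cvg_cst.
have -> : 0 = gamma * 0 / (2 * b) by rewrite mulr0 mul0r.
by apply: cvgM; [apply: cvgM => //|]; exact: cvg_cst.
Qed.

Hypotheses (F_smooth : smooth_on Omega F) (Rel_smooth : smooth_on Omega Rel).
Hypothesis sigma_smooth :
  smooth_on [set p : R * R * 'cV[R]_N * 'cV[R]_N | Omega p.1.2 /\ Omega p.2] sigma.
Hypotheses (U_smooth : smooth_on setT U) (U_Omega : forall p, Omega (U p)).

Section limits.
Variable p : R * R.
(** The node tends to [p] while the two steps tend to 0 independently, each staying nonzero. *)
Let G : set_system ((R * R) * (R * R)) :=
  filter_prod (nbhs p) (filter_prod (0 : R)^' (0 : R)^').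

Let cvg_q : z.1 @[z --> G] --> p.
Proof. exact: cvg_fst. Qed.

Let cvg_k : z.2.1 @[z --> G] --> (0 : R)^'.
Proof. by apply: (cvg_comp snd fst); [exact: cvg_snd|exact: cvg_fst]. Qed.

Let cvg_h : z.2.2 @[z --> G] --> (0 : R)^'.
Proof. by apply: (cvg_comp snd snd); exact: cvg_snd. Qed.

Let cvg_Nh : - z.2.2 @[z --> G] --> (0 : R)^'.
Proof. exact: (cvg_comp (fun z => z.2.2) -%R cvg_h (@dnbhs0_opp R)). Qed.

Let cvg0 (h : (R * R) * (R * R) -> R) :
  h z @[z --> G] --> (0 : R)^' -> h z @[z --> G] --> (0 : R).
Proof. by move=> h0; apply: cvg_trans h0 _; exact: nbhs_dnbhs. Qed.

Let cvg_shift (h : (R * R) * (R * R) -> R) v : h z @[z --> G] --> (0 : R) ->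
  z.1 + h z *: v @[z --> G] --> p.
Proof.
move=> h0; suff : z.1 + h z *: v @[z --> G] --> p + 0 *: v.
  by rewrite scale0r addr0.
by apply: cvgD => //; exact: cvgZr_tmp.
Qed.

Let cvg_U (q : (R * R) * (R * R) -> R * R) :
  q z @[z --> G] --> p -> U (q z) @[z --> G] --> U p.
Proof.
move=> qp; apply: (cvg_comp q U qp).
exact: smooth_on_continuous U_smooth _.
Qed.

Let cvg_sigma (h : (R * R) * (R * R) -> R) (u v : (R * R) * (R * R) -> 'cV[R]_N) :
  h z @[z --> G] --> (0 : R) -> u z @[z --> G] --> U p -> v z @[z --> G] --> U p ->
  sigma (z.1.1, z.1.2 + h z / 2, u z, v z) @[z --> G] --> sigma (p.1, p.2, U p, U p).
Proof.
move=> h0 up vp.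
apply: (cvg_comp (fun z : (R * R) * (R * R) => (z.1.1, z.1.2 + h z / 2, u z, v z)) sigma); last first.
  by apply: smooth_on_continuous sigma_smooth _; split => /=.
do 3!(apply: cvg_pair_nbhs => //).
  by apply: (cvg_comp fst fst cvg_q); exact: cvg_fst.
rewrite -[X in _ --> X]addr0 -(mul0r 2^-1); apply: cvgD.
  by apply: (cvg_comp fst snd cvg_q); exact: cvg_snd.
by apply: cvgM => //; exact: cvg_cst.
Qed.

Let cvg_alpha_right : alpha_right z.1 z.2.2 @[z --> G] --> (1%:M : 'M[R]_N).
Proof.
apply: cvg_alpha_of; first exact: cvg0.
by apply: cvg_sigma; [exact: cvg0|exact: cvg_U|apply: cvg_U; apply: cvg_shift; exact: cvg0].
Qed.

Let cvg_alpha_left : alpha_left z.1 z.2.2 @[z --> G] --> (1%:M : 'M[R]_N).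
Proof.
apply: cvg_alpha_of; first exact: cvg0.
by apply: cvg_sigma; [exact: cvg0|apply: cvg_U; apply: cvg_shift; exact: cvg0|exact: cvg_U].
Qed.

Let cvg_quotient (W : 'cV[R]_N -> 'cV[R]_N) (v : R * R) (h : (R * R) * (R * R) -> R) :
  smooth_on Omega W -> h z @[z --> G] --> (0 : R)^' ->
  diff_quotient (W \o U) v (z.1, h z) @[z --> G] --> 'D_v (W \o U) p.
Proof.
move=> sW h0.
apply: (cvg_comp (fun z : (R * R) * (R * R) => (z.1, h z)) (diff_quotient (W \o U) v)
  (cvg_pair cvg_q h0)).
apply: cvg_diff_quotient; last exact: continuous_derive_comp sW _ _.
move=> x; apply: diff_derivable; apply: differentiable_comp.
  exact: smooth_on_differentiable U_smooth _.
exact: smooth_on_differentiable sW _.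
Qed.

Let cvg_quotientU (v : R * R) (h : (R * R) * (R * R) -> R) :
  h z @[z --> G] --> (0 : R)^' ->
  diff_quotient U v (z.1, h z) @[z --> G] --> 'D_v U p.
Proof.
move=> h0.
apply: (cvg_comp (fun z : (R * R) * (R * R) => (z.1, h z)) (diff_quotient U v)
  (cvg_pair cvg_q h0)).
apply: cvg_diff_quotient; last exact: smooth_on_continuous_derive U_smooth _.
by move=> x; apply: diff_derivable; exact: smooth_on_differentiable U_smooth _.
Qed.

Let cvg_D (v : R * R) : 'D_v U z.1 @[z --> G] --> 'D_v U p.
Proof.
apply: (cvg_comp fst ('D_v U) cvg_q).
exact: smooth_on_continuous_derive U_smooth _.
Qed.

Let cvg_DF (v : R * R) : 'D_v (F \o U) z.1 @[z --> G] --> 'D_v (F \o U) p.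
Proof.
apply: (cvg_comp fst ('D_v (F \o U)) cvg_q).
exact: continuous_derive_comp F_smooth _ _.
Qed.

Let cvg_Rel : Rel (U z.1) @[z --> G] --> Rel (U p).
Proof.
apply: (cvg_comp (fun z : (R * R) * (R * R) => U z.1) Rel (cvg_U cvg_q)).
exact: smooth_on_continuous Rel_smooth _.
Qed.

Lemma cvg_truncation_error : truncation_error z.1 z.2.1 z.2.2 @[z --> G] --> (0 : 'cV[R]_N).
Proof.
(* The limit of each term: with both [alpha] equal to the identity, the [b] terms cancel, the halves
   add up to ['D_ex (F \o U) p], and the relaxation terms to [gamma *: Rel (U p)]. *)
have -> : 0 = 'D_et U p
    + 2^-1 *: (1%:M *m ('D_ex (F \o U) p - b *: 'D_ex U p))
    + 2^-1 *: (1%:M *m ('D_ex (F \o U) p + b *: 'D_ex U p))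
    + (gamma / 2) *: ((1%:M + 1%:M) *m Rel (U p))
    - ('D_et U p + 'D_ex (F \o U) p + gamma *: Rel (U p)).
  rewrite mulmxDl !mul1mx.
  move: ('D_et U p) ('D_ex U p) ('D_ex _ p) (Rel _) => x y z w.
  by apply/colP => k; rewrite !mxE; field.
apply: cvgB; last first.
  by apply: cvgD; [apply: cvgD; [exact: cvg_D|exact: cvg_DF]|apply: cvgZl_tmp; exact: cvg_Rel].
apply: cvgD; last first.
  by apply: cvgZl_tmp; apply: cvg_mulmx; [exact: cvgD|exact: cvg_Rel].
apply: cvgD; last first.
  apply: cvgZl_tmp; apply: cvg_mulmx => //; apply: cvgD; first exact: cvg_quotient.
  by apply: cvgZl_tmp; exact: cvg_quotientU.
apply: cvgD; first exact: cvg_quotientU.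
apply: cvgZl_tmp; apply: cvg_mulmx => //; apply: cvgB; first exact: cvg_quotient.
by apply: cvgZl_tmp; exact: cvg_quotientU.
Qed.

End limits.

Lemma derive1_et t x : derive1 (fun s => U (s, x)) t = 'D_et U (t, x).
Proof.
have dU : derivable U ((0, x) + t *: et) et.
  by apply: diff_derivable; exact: smooth_on_differentiable U_smooth _.
have E (s : R) : (s, x) = (0, x) + s *: et.
  by congr pair => /=; [rewrite add0r [_ *: _]mulr1|rewrite [_ *: _]mulr0 addr0].
have -> : (fun s => U (s, x)) = (fun s => U ((0, x) + s *: et)).
  by apply/funext => s; rewrite -E.
by have D := is_derive_line dU; rewrite derive1E derive_val -E.
Qed.

Lemma derive1_ex t x :
  derive1 (fun y => F (U (t, y))) x = 'D_ex (F \o U) (t, x).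
Proof.
have dU : derivable (F \o U) ((t, 0) + x *: ex) ex.
  apply: diff_derivable; apply: differentiable_comp.
    exact: smooth_on_differentiable U_smooth _.
  exact: smooth_on_differentiable F_smooth _.
have E (y : R) : (t, y) = (t, 0) + y *: ex.
  by congr pair => /=; [rewrite [_ *: _]mulr0 addr0|rewrite add0r [_ *: _]mulr1].
have -> : (fun y => F (U (t, y))) = (fun y => (F \o U) ((t, 0) + y *: ex)).
  by apply/funext => y; rewrite -E.
by have D := is_derive_line dU; rewrite derive1E derive_val -E.
Qed.

(** An exact identity, with no remainder. On the left interface, the minus sign before the flux is
    absorbed by taking quotients with step [- Dx M]. *)
Lemma scheme_truncation_error (M : mesh R) m i : Dt M != 0 -> Dx M != 0 ->
  let V := sample M U in
  let q := (time M m, node M i) in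
  scheme_lhs F gamma b sigma M V m i - scheme_rhs F Rel gamma b sigma M V m i
  - ('D_et U q + 'D_ex (F \o U) q + gamma *: Rel (U q))
  = truncation_error q (Dt M) (Dx M).
Proof.
move=> dt0 dx0 V q.
have Eex h : q + h *: ex = (time M m, node M i + h).
  by congr pair => /=; [rewrite [_ *: _]mulr0 addr0|rewrite [_ *: _]mulr1].
have Vt : V m.+1 i = U (q + Dt M *: et).
  congr (U _); congr pair => /=; last by rewrite [_ *: _]mulr0 addr0.
  by rewrite [_ *: _]mulr1 /time mulrSr mulrDl mul1r addrA.
have nodeD (h : int) : node M (i + h) = node M i + h%:~R * Dx M.
  by rewrite /node intrD mulrDl addrA.
have Vp : V m (i + 1) = U (q + Dx M *: ex).
  by rewrite Eex /V /sample nodeD mul1r.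
have Vm : V m (i - 1) = U (q + (- Dx M) *: ex).
  by rewrite Eex /V /sample nodeD mulN1r.
have aR : alpha gamma b sigma M V m i = alpha_right q (Dx M).
  by rewrite /alpha /alpha_inv /Isigma /sigma_half Vp.
have aL : alpha gamma b sigma M V m (i - 1) = alpha_left q (Dx M).
  (* The left interface, half a cell to the right of the previous node, is half a cell to the left
     of the current one. *)
  have xm : interface M (i - 1) = node M i + (- Dx M) / 2.
    by rewrite /interface nodeD; field.
  by rewrite /alpha /alpha_inv /Isigma /sigma_half subrK Vm xm.
rewrite /scheme_lhs /scheme_rhs aR aL /F_HLL subrK Vt Vp Vm.
rewrite -[V m i]/(U q) /truncation_error /diff_quotient /=.
move: ('D_et U q) ('D_ex _ q) => Ut Fx.
move: (alpha_right _ _) (alpha_left _ _) (Rel _) => A B r.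
move: (F (U (q + Dx M *: ex))) (F (U (q + (- Dx M) *: ex))) (F (U q)).
move: (U (q + Dt M *: et)) (U (q + Dx M *: ex)) (U (q + (- Dx M) *: ex)) (U q).
move=> Ut' Up Um U0 Fp Fm F0.
rewrite !(mulmxDl, mulmxDr, mulmxBl, mulmxBr, mulmxN, mulNmx, =^~ scalemxAr).
by apply/colP => k; rewrite !mxE; field; rewrite dt0 dx0.
Qed.

Lemma truncation_error_uniform (K : set (R * R)) (e : R) : compact K -> 0 < e ->
  exists2 d : R, 0 < d & forall k h, 0 < `|k| < d -> 0 < `|h| < d ->
    forall q, K q -> `|truncation_error q k h| <= e.
Proof.
move=> cK e0.
have H p : K p -> \forall q \near p & kh \near filter_prod (0 : R)^' (0 : R)^',
    `|truncation_error q kh.1 kh.2| <= e.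
  move=> _; have /cvgrPdist_le/(_ e e0) := cvg_truncation_error p.
  by apply: filterS => -[q [k h]] /=; rewrite sub0r normrN.
(* The near-covering form of compactness merges the local neighbourhoods of step pairs into one,
   valid for all [q] in [K]. *)
have [[A B] /= [/nbhs_ballP[d1 d10 dA] /nbhs_ballP[d2 d20 dB]] AB] :=
  (compact_near_coveringP K).1 cK _ _ _ _ H.
exists (Num.min d1 d2); first by rewrite lt_min; apply/andP.
move=> k h; rewrite !lt_min !normr_gt0 => /and3P[k0 kd1 _] /and3P[h0 _ hd2] q Kq.
apply: (AB (k, h)) => //; split => /=.
  by apply: dA => //; rewrite -ball_normE /= sub0r normrN.
by apply: dB => //; rewrite -ball_normE /= sub0r normrN.
Qed.

End truncation.

Theorem theorem3 (R : realType) (N : nat) (Omega : set 'cV[R]_N)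
    (F Rel : 'cV[R]_N -> 'cV[R]_N) (gamma b : R)
    (sigma : R * R * 'cV[R]_N * 'cV[R]_N -> 'M[R]_N)
    (Omega_open : open Omega) (Omega_convex : convex_set Omega)
    (F_smooth : smooth_on Omega F) (Rel_smooth : smooth_on Omega Rel)
    (F_hyperbolic : forall u, Omega u -> hyperbolic_at F u)
    (gamma_gt0 : 0 < gamma) (b_gt0 : 0 < b)
    (sigma_smooth :
      smooth_on [set p : R * R * 'cV[R]_N * 'cV[R]_N |
                  Omega p.1.2 /\ Omega p.2] sigma)
    (sigma_O : sigma_variation_O Omega b sigma) :
  consistent Omega F Rel gamma b sigma /\
  invariant_domain Omega F Rel gamma b sigma.
Proof.
split; last exact: invariant_domain_convex.
move=> U U_smooth U_Omega K cK e e0.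
(* The threshold [d] is chosen before the mesh and serves every node in [K], wherever the mesh has
   its origin. *)
have [d d0 err] := truncation_error_uniform gamma b F_smooth Rel_smooth
  sigma_smooth U_smooth U_Omega cK e0.
exists d; split => // M [dt0 dx0 _] dtd dxd m i Kq V t x _ _.
rewrite derive1_et// (derive1_ex F_smooth)// scheme_truncation_error ?gt_eqF//.
by apply: err => //; rewrite gtr0_norm// ?dt0 ?dx0.
Qed.
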